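(* Let $P$ and $Q$ be finite generalized ranked posets, and let $P\times Q$ be their direct product. Then $$\mathcal{M}_{P\times Q}(z)=\mathcal{M}_P(z)\,\mathcal{M}_Q(z).$$
   Context: Here $\mathbb{N}$ includes $0$. A generalized ranked poset is a poset $(P,\leq)$ together with a function $|\cdot|:P\to\mathbb{N}$ (generalized rank function) such that (i) $|p|=0$ if and only if $p$ is minimal, and (ii) $p<q$ implies $|p|<|q|$. The Möbius function $\mu$ of a finite poset $P$ is the integer-valued function on $P\times P$ given by $\mu(p,p)=1$, $\mu(p,q)=-\sum_{p\leq r<q}\mu(p,r)$ for $p<q$, and $\mu(p,q)=0$ if $p\not\leq q$. The Möbius polynomial of a finite generalized ranked poset $P$ is $\mathcal{M}_P(z)=\sum_{p\leq q}\mu(p,q)z^{|q|-|p|}$, the sum being over all pairs $(p,q)\in P\times P$ with $p\leq q$. The direct product of generalized ranked posets $P$ and $Q$ is the set $P\times Q$ with $(p,q)\leq(p',q')$ if and only if $p\leq p'$ and $q\leq q'$, and with generalized rank function $|(p,q)|=|p|_P+|q|_Q$. *)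

(* Defs.v *)
From mathcomp Require Import all_boot all_order all_algebra.

Set Implicit Arguments.
Unset Strict Implicit.
Unset Printing Implicit Defensive.

Import Order.TTheory GRing.Theory.
Local Open Scope ring_scope.

Definition is_minimal d (P : porderType d) (p : P) : Prop :=
  forall x : P, ~ (x < p)%O.

Record genRank d (P : porderType d) := GenRank {
  grank :> P -> nat;
  grank_eq0 : forall p, grank p = 0%N <-> is_minimal p;
  grank_lt : forall p q, (p < q)%O -> (grank p < grank q)%N }.

Section ProductRank.
Variables (dP dQ : Order.disp_t) (P : porderType dP) (Q : porderType dQ).
Variables (rP : genRank P) (rQ : genRank Q).

Definition prod_grank (x : P *p Q) : nat := (rP x.1 + rQ x.2)%N.

Lemma grank_le d (T : porderType d) (r : genRank T) (p q : T) :
  (p <= q)%O -> (r p <= r q)%N.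
Proof. by rewrite le_eqVlt => /predU1P[-> // | /(grank_lt r)/ltnW]. Qed.

Lemma prod_grank_eq0 x : prod_grank x = 0%N <-> is_minimal x.
Proof.
case: x => p q; split=> [/eqP | min_pq].
  rewrite addn_eq0 => /andP[/eqP/grank_eq0 min_p /eqP/grank_eq0 min_q] [p' q'].
  rewrite lt_pair => /and3P[neq le_p le_q].
  case/orP: neq => neq.
    by apply: (min_p p'); rewrite lt_neqAle neq.
  by apply: (min_q q'); rewrite lt_neqAle neq.
apply/eqP; rewrite addn_eq0; apply/andP; split; apply/eqP/grank_eq0 => /=.
  move=> p' lt_p; apply: (min_pq (p', q)).
  by rewrite lt_pair (lt_eqF lt_p) (ltW lt_p) lexx.
move=> q' lt_q; apply: (min_pq (p, q')).
by rewrite lt_pair (lt_eqF lt_q) (ltW lt_q) lexx orbT.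
Qed.

Lemma prod_grank_lt x y : (x < y)%O -> (prod_grank x < prod_grank y)%N.
Proof.
case: x y => [p q] [p' q']; rewrite lt_pair /prod_grank /=.
case/and3P=> neq le_p le_q; case/orP: neq => neq.
  by rewrite -addSn leq_add ?grank_le// grank_lt// lt_neqAle neq.
by rewrite -addnS leq_add ?grank_le// grank_lt// lt_neqAle neq.
Qed.

Definition prod_genRank : genRank (P *p Q) :=
  GenRank prod_grank_eq0 prod_grank_lt.

End ProductRank.

Section Mobius.
Variables (d : Order.disp_t) (P : finPOrderType d).
Implicit Types p q r : P.

(* [n] is recursion fuel; [#|P|] is always enough, since every recursive call
   replaces [q] by a strictly smaller element (see [mobius_lt]). *)
Fixpoint mobius_rec (n : nat) p q : int :=
  if p == q then 1 else
  if n is n'.+1 then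
    if (p < q)%O then - \sum_(r | (p <= r < q)%O) mobius_rec n' p r else 0
  else 0.

Definition mobius p q : int := mobius_rec #|P| p q.

Lemma mobius_rec_stable m n p q :
  (#|[pred r | (r < q)%O]| < m)%N -> (#|[pred r | (r < q)%O]| < n)%N ->
  mobius_rec m p q = mobius_rec n p q.
Proof.
elim: m n q => [|m IHm] [|n] q //= lt_m lt_n.
case: eqP => // _; case: ifP => // _; congr (- _).
apply: eq_bigr => r /andP[_ lt_rq].
have lt_card: (#|[pred s | (s < r)%O]| < #|[pred s | (s < q)%O]|)%N.
  apply/proper_card/properP; split.
    by apply/subsetP => s; rewrite !inE => /lt_trans; apply.
  by exists r; rewrite !inE ?ltxx.
by apply: IHm; apply: leq_trans lt_card _.
Qed.

Lemma mobius_refl p : mobius p p = 1.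
Proof. by rewrite /mobius; case: #|P| => [|n] /=; rewrite eqxx. Qed.

Lemma mobius_lt p q : (p < q)%O ->
  mobius p q = - \sum_(r | (p <= r < q)%O) mobius p r.
Proof.
move=> lt_pq.
have card_lt (s : P) : (#|[pred r | (r < s)%O]| < #|P|)%N.
  by apply/proper_card/properP; split; [apply/subsetP | exists s; rewrite !inE ?ltxx].
rewrite {1}/mobius (@mobius_rec_stable #|P| #|P|.+1) ?card_lt 1?ltnW ?ltnS //=.
by rewrite (lt_eqF lt_pq) lt_pq.
Qed.

Lemma mobius_nle p q : ~~ (p <= q)%O -> mobius p q = 0.
Proof.
rewrite le_eqVlt negb_or => /andP[/negPf neq /negPf nlt].
by rewrite /mobius; case: #|P| => [|n] /=; rewrite neq ?nlt.
Qed.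

End Mobius.

Definition mobius_poly d (P : finPOrderType d) (r : genRank P) : {poly int} :=
  \sum_(x : P * P | (x.1 <= x.2)%O) mobius x.1 x.2 *: 'X^(r x.2 - r x.1).
Arguments mobius_poly {d} P r.

(* Main.v *)
Require Import Defs.
From mathcomp Require Import all_boot all_order all_algebra.

(** An interval of a product poset is the product of the corresponding
    intervals of the factors, so the sum of [mobius p r * mobius q s] over all
    [(r, s)] between [(p, q)] and [(p', q')] factors as
    [(p == p')%:R * (q == q')%:R].  The vanishing of such interval sums, with
    value [1] on trivial intervals, characterizes the Moebius function
    ([mobius_unique]); hence the Moebius function of the product is the product
    of the Moebius functions ([mobius_prod]).  Ranks add, so each monomial also
    factors, and the polynomial identity is the distributive law after regrouping
    the quadruple [((p, q), (p', q'))] as [((p, p'), (q, q'))]. *)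

Set Implicit Arguments.
Unset Strict Implicit.
Unset Printing Implicit Defensive.

Import Order.TTheory GRing.Theory.
Local Open Scope ring_scope.

Section MobiusCharacterization.
Variables (d : Order.disp_t) (P : finPOrderType d).
Implicit Types p q r : P.

Lemma sum_itv_recr (f : P -> int) p q : (p <= q)%O ->
  \sum_(r | (p <= r <= q)%O) f r = f q + \sum_(r | (p <= r < q)%O) f r.
Proof.
move=> le_pq; rewrite (bigD1 q) ?le_pq ?lexx //=; congr (_ + _).
by apply: eq_bigl => r; rewrite lt_neqAle -andbA [(r != q) && _]andbC.
Qed.

Lemma sum_mobius p q : (p <= q)%O ->
  \sum_(r | (p <= r <= q)%O) mobius p r = (p == q)%:R.
Proof.
move=> le_pq; rewrite sum_itv_recr //; case: eqVneq => [<- | neq_pq].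
  rewrite mobius_refl big_pred0 ?addr0 // => r.
  by apply: (introF idP) => /andP[/le_lt_trans le_p /le_p]; rewrite ltxx.
by rewrite mobius_lt ?addNr // lt_neqAle neq_pq.
Qed.

(** The interval sums form a triangular system, so they determine [f] by
    induction on the number of elements strictly below the argument. *)
Lemma mobius_unique p (f : P -> int) :
    (forall q, (p <= q)%O -> \sum_(r | (p <= r <= q)%O) f r = (p == q)%:R) ->
  forall q, (p <= q)%O -> f q = mobius p q.
Proof.
move=> sum_f q; have [n] := ubnP #|[pred r | (r < q)%O]|.
elim: n q => // n IHn q; rewrite ltnS => le_n le_pq.
apply: (addIr (\sum_(r | (p <= r < q)%O) f r)).
rewrite -sum_itv_recr // sum_f // -sum_mobius // sum_itv_recr //; congr (_ + _).
apply: eq_bigr => r /andP[le_pr lt_rq]; symmetry; apply: IHn => //.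
apply: leq_trans le_n; apply/proper_card/properP; split.
  by apply/subsetP => s; rewrite !inE => /lt_trans; apply.
by exists r; rewrite !inE ?ltxx.
Qed.

End MobiusCharacterization.

Section MobiusProduct.
Variables (dP dQ : Order.disp_t) (P : finPOrderType dP) (Q : finPOrderType dQ).

Lemma mobius_prod (x y : P *p Q) : (x <= y)%O ->
  mobius x y = mobius x.1 y.1 * mobius x.2 y.2.
Proof.
move=> le_xy; symmetry.
pose f (z : P *p Q) := mobius x.1 z.1 * mobius x.2 z.2.
apply: (mobius_unique (f := f) _ le_xy) => {le_xy}y.
rewrite Order.ProdOrder.leEprod => /andP[le1 le2].
rewrite (eq_bigl (fun z : P *p Q =>
  (x.1 <= z.1 <= y.1)%O && (x.2 <= z.2 <= y.2)%O)); last first.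
  by move=> z; rewrite !Order.ProdOrder.leEprod andbACA.
rewrite -(pair_big (fun r => x.1 <= r <= y.1)%O (fun s => x.2 <= s <= y.2)%O
  (fun r s => mobius x.1 r * mobius x.2 s)) -big_distrlr /=.
by rewrite !sum_mobius // -natrM mulnb.
Qed.

End MobiusProduct.

Theorem theorem4p2 (dP dQ : Order.disp_t)
    (P : finPOrderType dP) (Q : finPOrderType dQ)
    (rP : genRank P) (rQ : genRank Q) :
  mobius_poly (P *p Q)%type (prod_genRank rP rQ)
    = (mobius_poly P rP * mobius_poly Q rQ)%R.
Proof.
rewrite /mobius_poly big_distrlr pair_big /=.
pose swap_mid (A B C D : Type) (u : (A * B) * (C * D)) :=
  ((u.1.1, u.2.1), (u.1.2, u.2.2)).
rewrite (reindex (swap_mid P P Q Q)) /=; last first.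
  by exists (swap_mid P Q P Q) => -[[? ?] [? ?]] _.
apply: eq_big => -[[p p'] [q q']] /=.
  by rewrite Order.ProdOrder.leEprod.
move=> le_xy; rewrite mobius_prod //=.
move: le_xy; rewrite Order.ProdOrder.leEprod => /andP[/= le_p le_q].
rewrite -scalerAl -scalerAr scalerA -exprD; congr (_ *: 'X^_).
(* Truncated subtraction is additive here because ranks are monotone. *)
by rewrite /prod_grank /= subnDA -addnBAC ?grank_le // -addnBA ?grank_le.
Qed.
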